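(* Let $\Omega$ be a topological space. Suppose that $\mathcal{K}\subset\mathcal{C}(\Omega)$ is a convex set that is stable under maxima, contains constants and such that for any constant $c$ it holds $\mathcal{K}+c\subset\mathcal{K}$. Let $f\in\mathcal{K}$. Then the tangent cone to $\mathcal{K}$ at $f$, i.e., the cone $$\mathcal{F}=\big\{\lambda(g-f)\mid g\in\mathcal{K},\ \lambda\geq 0\big\},$$ is a convex cone, is stable under maxima and contains constants.
   Context: $\mathcal{C}(\Omega)$ is the Banach space of bounded continuous real functions on $\Omega$. A subset of $\mathcal{C}(\Omega)$ is stable under maxima if the pointwise maximum $f\vee g$ of any two of its elements $f,g$ belongs to it. ''Contains constants'' means that it contains all constant functions. *)

(* Defs.v *)
From HB Require Import structures.
From mathcomp Require Import all_boot all_order all_algebra.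
From mathcomp Require Import all_classical all_reals all_analysis.

Set Implicit Arguments.
Unset Strict Implicit.
Unset Printing Implicit Defensive.

Import Order.TTheory GRing.Theory Num.Theory.
Import numFieldNormedType.Exports.

Local Open Scope classical_set_scope.
Local Open Scope ring_scope.

Section BoundedContinuous.
Context (R : realType) (Omega : topologicalType).
Implicit Types f g : Omega -> R.

Definition bounded_continuous : {pred (Omega -> R)} :=
  [pred f | `[< continuous f /\ bounded_fun f >]].

Lemma bounded_continuousP f :
  reflect (continuous f /\ bounded_fun f) (f \in bounded_continuous).
Proof. exact: asboolP. Qed.

Lemma bounded_funPex f :
  bounded_fun f <-> exists M : R, forall x, `|f x| <= M.
Proof.
split=> [[M [_ fM]]|[M fM]].
  by exists (M + 1) => x; apply: fM => //; rewrite ltrDl.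
exists M; split; first exact: num_real.
by move=> N MN x _ /=; rewrite (le_trans (fM x)) // ltW.
Qed.

Lemma bounded_continuous_submod : submod_closed bounded_continuous.
Proof.
split=> [|a f g /bounded_continuousP[cf bf] /bounded_continuousP[cg bg]].
  apply/bounded_continuousP; split; first exact: cst_continuous.
  by apply/bounded_funPex; exists 0 => x; rewrite normr0.
apply/bounded_continuousP; split.
  by move=> x; apply: cvgD; [apply: cvgZr; exact: cf|exact: cg].
move/bounded_funPex : bf => [M fM]; move/bounded_funPex : bg => [N gN].
apply/bounded_funPex; exists (`|a| * M + N) => x.
by rewrite (le_trans (ler_normD _ _)) // lerD // normrM ler_wpM2l.
Qed.

HB.instance Definition _ :=
  GRing.isSubmodClosed.Build R (Omega -> R) bounded_continuous
    bounded_continuous_submod.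

Lemma bounded_continuous_cst (c : R) :
  (cst c : Omega -> R) \in bounded_continuous.
Proof.
apply/bounded_continuousP; split; first exact: cst_continuous.
by apply/bounded_funPex; exists `|c| => x.
Qed.

Lemma bounded_continuous_max f g : f \in bounded_continuous ->
  g \in bounded_continuous -> f \max g \in bounded_continuous.
Proof.
move=> /bounded_continuousP[cf bf] /bounded_continuousP[cg bg].
apply/bounded_continuousP; split.
  by move=> x; apply: continuous_max; [exact: cf|exact: cg].
move/bounded_funPex : bf => [M fM]; move/bounded_funPex : bg => [N gN].
apply/bounded_funPex; exists (Num.max M N) => x /=.
by rewrite le_max /Num.max; case: ifP => _; rewrite ?fM ?gN ?orbT.
Qed.

Record Cb := MkCb {
  Cb_fun :> Omega -> R ;
  Cb_funP : Cb_fun \in bounded_continuous }.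

HB.instance Definition _ := [isSub for Cb_fun].
HB.instance Definition _ := [Choice of Cb by <:].
HB.instance Definition _ := [SubChoice_isSubZmodule of Cb by <:].
HB.instance Definition _ := [SubZmodule_isSubLmodule of Cb by <:].

Definition Cb_cst (c : R) : Cb := MkCb (bounded_continuous_cst c).

Definition Cb_max (f g : Cb) : Cb :=
  MkCb (bounded_continuous_max (Cb_funP f) (Cb_funP g)).

Definition stable_under_maxima (K : set Cb) :=
  forall f g : Cb, K f -> K g -> K (Cb_max f g).

Definition contains_constants (K : set Cb) := forall c, K (Cb_cst c).

End BoundedContinuous.

Arguments Cb_cst {R} Omega c.

Definition convex_cone (R : realType) (V : lmodType R) (F : set V) :=
  convex_set (F : set (convex_lmodType V)) /\
  forall (l : R) (v : V), 0 <= l -> F v -> F (l *: v).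

(* No closure is taken. *)
Definition tangent_cone (R : realType) (V : lmodType R) (K : set V) (f : V) :
  set V := [set v | exists l g, [/\ 0 <= l, K g & v = l *: (g - f)]].

(* Main.v *)
(** Since [K] is convex and contains [f], a multiple [l (g - f)] with [g] in [K]
can be rewritten as [M (g' - f)] with [g'] in [K] for every [M >= l], [M > 0].
Two elements of the tangent cone thus share a common factor, and the operations
(convex combinations, maxima) can be performed on the elements of [K]. *)
Require Import Defs.
From mathcomp Require Import all_boot all_order all_algebra.
From mathcomp Require Import all_classical all_reals all_analysis.

Import Order.TTheory GRing.Theory Num.Theory.
Local Open Scope classical_set_scope.
Local Open Scope ring_scope.

(** Restates [convex_set], whose weights live in an interval type and whose membership is boolean,
    for a real [t] with explicit bounds. *)
Lemma convex_setE (R : realType) (V : lmodType R) (K : set V) (t : R) (x y : V) :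
  convex_set (K : set (convex_lmodType V)) ->
  0 <= t -> t <= 1 -> K x -> K y -> K (t *: x + (1 - t) *: y).
Proof.
move=> convK t0 t1 /mem_set Kx /mem_set Ky; apply: set_mem.
exact: (convK x y (Itv01 t0 t1)).
Qed.

Section TangentCone.
Context (R : realType) (V : lmodType R) (K : set V) (f : V).
Hypothesis convK : convex_set (K : set (convex_lmodType V)).
Hypothesis Kf : K f.

Lemma tangent_cone_rescale (l M : R) (g : V) : 0 <= l -> l <= M -> 0 < M ->
  K g -> exists2 g', K g' & l *: (g - f) = M *: (g' - f).
Proof.
(* With weight [l / M] in [[0, 1]], this point of the segment from [f] to [g] satisfies
   [g' - f = (l / M) *: (g - f)]. *)
move=> l0 lM M0 Kg; exists ((l / M) *: g + (1 - l / M) *: f).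
  apply: convex_setE => //; first by rewrite divr_ge0 // ltW.
  by rewrite ler_pdivrMr // mul1r.
rewrite scalerBl scale1r addrCA addrAC subrr add0r -scalerBr scalerA.
by rewrite mulrC divfK // gt_eqF.
Qed.

Lemma tangent_cone_common (v w : V) : tangent_cone K f v -> tangent_cone K f w ->
  exists M g h, [/\ 0 <= M, K g, K h, v = M *: (g - f) & w = M *: (h - f)].
Proof.
move=> [l [g [l0 Kg ->]]] [m [h [m0 Kh ->]]].
(* The summand [1] keeps the common factor positive even when [l = m = 0]; rescaling divides by
   it. *)
have M0 : 0 < l + m + 1 by rewrite ltr_pwDr // addr_ge0.
have lM : l <= l + m + 1 by rewrite -addrA lerDl addr_ge0.
have mM : m <= l + m + 1 by rewrite addrAC lerDr addr_ge0.
have [g' Kg' eg] := tangent_cone_rescale _ _ _ l0 lM M0 Kg.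
have [h' Kh' eh] := tangent_cone_rescale _ _ _ m0 mM M0 Kh.
by exists (l + m + 1), g', h'; split => //; exact: ltW.
Qed.

Lemma convex_cone_tangent_cone : convex_cone (tangent_cone K f).
Proof.
split=> [v w t|l v l0 [m [g [m0 Kg ->]]]]; last first.
  by exists (l * m), g; split; rewrite ?scalerA ?mulr_ge0.
move=> /set_mem Fv /set_mem Fw; apply: mem_set.
have [M [g [h [M0 Kg Kh -> ->]]]] := tangent_cone_common _ _ Fv Fw.
exists M, (t%:num *: g + (1 - t%:num) *: h); split => //.
  by apply: convex_setE.
(* The abstract convex combination unfolds by conversion. After [M] is factored out, the weights of
   [f] add up to 1. *)
transitivity (t%:num *: (M *: (g - f)) + (1 - t%:num) *: (M *: (h - f))) => //.
rewrite !scalerA ![_ * M]mulrC -!scalerA -scalerDr; congr (_ *: _).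
by rewrite !scalerBr addrACA -opprD -scalerDl subrKC scale1r.
Qed.

End TangentCone.

(** Translations and multiplication by [M >= 0] are monotone on the reals, so they commute with the
    pointwise maximum. *)
Lemma Cb_max_scale_sub (R : realType) (Omega : topologicalType) (M : R)
    (f g h : Cb R Omega) : 0 <= M ->
  Cb_max (M *: (g - f)) (M *: (h - f)) = M *: (Cb_max g h - f).
Proof.
move=> M0; apply/val_inj/funext => x /=.
by rewrite -[LHS]/(Num.max (M * (g x - f x)) (M * (h x - f x)))
  -[RHS]/(M * (Num.max (g x) (h x) - f x)) -maxr_pMr // -addr_maxl.
Qed.

Theorem proposition2p4 (R : realType) (Omega : topologicalType)
    (K : set (Cb R Omega))
    (convK : convex_set (K : set (convex_lmodType (Cb R Omega))))
    (maxK : stable_under_maxima K)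
    (cstK : contains_constants K)
    (addK : forall c : R, [set g + Cb_cst Omega c | g in K] `<=` K)
    (f : Cb R Omega) (Kf : K f) :
  [/\ convex_cone (tangent_cone K f),
      stable_under_maxima (tangent_cone K f) &
      contains_constants (tangent_cone K f)].
Proof.
split; first exact: convex_cone_tangent_cone.
- move=> v w Fv Fw.
  have [M [g [h [M0 Kg Kh -> ->]]]] := tangent_cone_common _ _ _ _ convK Kf _ _ Fv Fw.
  exists M, (Cb_max g h); split => //; first exact: maxK.
  exact: Cb_max_scale_sub.
(* The constant [c] is the difference between [f] and its translate [f + c], which [addK] keeps in
   [K]. *)
- move=> c; exists 1, (f + Cb_cst Omega c); split => //.
    by apply: (addK c); exists f.
  by rewrite scale1r addrC addKr.
Qed.
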